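(* Let $P\subseteq\mathbb{R}^n$ be a nonempty integral polyhedron of dimension smaller than $n$ such that no integer point lies in the relative interior of $P$. Then for each $k\in\mathbb{N}$ there exists a relaxation $Q$ of $P$ such that $Q^{(k)}$ is not contained in $\operatorname{aff}(P)$.
   Context: For a polyhedron $Q\subseteq\mathbb{R}^n$, $Q_I:=\operatorname{conv}(Q\cap\mathbb{Z}^n)$; $Q$ is integral if $Q=Q_I$. A relaxation of an integral polyhedron $P\subseteq\mathbb{R}^n$ is a rational polyhedron $Q\subseteq\mathbb{R}^n$ with $Q\cap\mathbb{Z}^n=P\cap\mathbb{Z}^n$. A CG inequality for $Q$ is $cx\le\lfloor\delta\rfloor$ with $c\in\mathbb{Z}^n$ and $cx\le\delta$ valid for $Q$. The CG closure $Q'$ is the set of points of $Q$ satisfying all CG inequalities for $Q$; $Q^{(0)}:=Q$, $Q^{(k)}:=(Q^{(k-1)})'$. $\operatorname{aff}(S)$ is the affine hull of $S$. *)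

(* Defs.v *)
From mathcomp Require Import all_boot all_order all_algebra.
From mathcomp Require Import reals.
Set Implicit Arguments. Unset Strict Implicit. Unset Printing Implicit Defensive.
Import Order.TTheory GRing.Theory Num.Theory.
Local Open Scope ring_scope.

Section Defs.
Variables (R : realType) (n : nat).
Local Notation pt := 'rV[R]_n.

Definition dotp (c x : pt) : R := \sum_(i < n) c 0 i * x 0 i.

Definition polyh_of (m : nat) (A : 'M[R]_(m, n)) (b : 'cV[R]_m) : pt -> Prop :=
  fun x => forall j : 'I_m, \sum_(i < n) A j i * x 0 i <= b j 0.

Definition is_polyhedron (Q : pt -> Prop) : Prop :=
  exists m (A : 'M[R]_(m, n)) (b : 'cV[R]_m), forall x, Q x <-> polyh_of A b x.

Definition is_rational (r : R) : Prop := exists q : rat, r = ratr q.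

Definition is_rational_polyhedron (Q : pt -> Prop) : Prop :=
  exists m (A : 'M[R]_(m, n)) (b : 'cV[R]_m),
    (forall j i, is_rational (A j i)) /\ (forall j, is_rational (b j 0)) /\
    (forall x, Q x <-> polyh_of A b x).

Definition is_int_pt (x : pt) : Prop := forall i, x 0 i \is a Num.int.

Definition conv (S : pt -> Prop) : pt -> Prop :=
  fun x => exists m (p : 'I_m -> pt) (l : 'I_m -> R),
    (forall k, S (p k)) /\ (forall k, 0 <= l k) /\ \sum_(k < m) l k = 1 /\
    x = \sum_(k < m) l k *: p k.

Definition aff (S : pt -> Prop) : pt -> Prop :=
  fun x => exists m (p : 'I_m -> pt) (l : 'I_m -> R),
    (forall k, S (p k)) /\ \sum_(k < m) l k = 1 /\
    x = \sum_(k < m) l k *: p k.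

Definition int_hull (Q : pt -> Prop) : pt -> Prop :=
  conv (fun x => Q x /\ is_int_pt x).

Definition is_integral_polyhedron (P : pt -> Prop) : Prop :=
  is_polyhedron P /\ forall x, P x <-> int_hull P x.

(* dim P < n : P contains no n+1 affinely independent points *)
Definition dim_lt_n (P : pt -> Prop) : Prop :=
  forall x : 'I_n.+1 -> pt, (forall i, P (x i)) ->
    (\rank (\matrix_(i < n) (x (lift ord0 i) - x ord0)) < n)%N.

(* relative interior (w.r.t. the sup norm; all norms on R^n are equivalent) *)
Definition relint (P : pt -> Prop) : pt -> Prop :=
  fun x => P x /\ exists eps : R, 0 < eps /\
    forall y, aff P y -> (forall i, `|y 0 i - x 0 i| < eps) -> P y.

Definition is_relaxation (P Q : pt -> Prop) : Prop :=
  is_rational_polyhedron Q /\ forall x, is_int_pt x -> (Q x <-> P x).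

Definition cg_closure (Q : pt -> Prop) : pt -> Prop :=
  fun x => Q x /\ forall (c : 'rV[int]_n) (delta : R),
    (forall y, Q y -> dotp (map_mx intr c) y <= delta) ->
    dotp (map_mx intr c) x <= (Num.floor delta)%:~R.

Definition cg_iter (k : nat) (Q : pt -> Prop) : pt -> Prop := iter k cg_closure Q.

End Defs.

(* Main.v *)
Require Import Defs.
From mathcomp Require Import all_boot all_order all_algebra.
From mathcomp Require Import reals boolp.
From mathcomp Require Import ring lra.
Import Order.TTheory GRing.Theory Num.Theory.
Local Open Scope ring_scope.

(* Let P have facets f_j <= 0 in aff(P). Rationality of P makes the f_j rational:
   the integer points of a facet span its affine hull, which determines f_j up to
   a positive factor on aff(P). Since dim P < n, some rational affine functional
   tau vanishes on P, is integral at integer points, and increases by 1 along an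
   integer vector v. Put
     Q = {y : t >= 0, y - t v in aff(P), f_j(y - t v) + eps t <= 0},  t = tau y.
   An integer y in Q with t > 0 would project to the integer point y - t v of
   relint(P), so Q is a relaxation of P. For x in relint(P) and eps small, Q
   contains x + t v for 0 <= t <= k + 1, and one CG closure shortens such a
   segment by at most 1; hence x + v lies in the k-th closure but not in aff(P). *)

(** * Homogeneous coordinates and affine functionals *)

(** Appending a coordinate 1 makes affine combinations linear: affine hulls become row spaces, and
    affine functionals become columns. *)
Definition hom (F : pzRingType) (n : nat) (x : 'rV[F]_n) : 'rV[F]_(n + 1) :=
  row_mx x 1%:M.

(* A column (c; d) encodes the affine functional c x + d, with linear part lin. *)
Definition ev (F : pzRingType) (n : nat) (h : 'cV[F]_(n + 1)) (x : 'rV[F]_n) : F :=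
  (hom F n x *m h) 0 0.

Definition lin (F : pzRingType) (n : nat) (h : 'cV[F]_(n + 1)) (v : 'rV[F]_n) : F :=
  (row_mx v 0 *m h) 0 0.

Arguments hom {F n} x.
Arguments ev {F n} h x.
Arguments lin {F n} h v.

Lemma hom_sum (F : fieldType) (n m : nat) (p : 'I_m -> 'rV[F]_n) (l : 'I_m -> F) :
  \sum_(k < m) l k = 1 ->
  hom (\sum_(k < m) l k *: p k) = \sum_(k < m) l k *: hom (p k).
Proof.
move=> l1; rewrite /hom; apply/rowP => i; rewrite summxE.
rewrite -[i]splitK; case: (split i) => j; rewrite [unsplit _]/=.
  by rewrite row_mxEl summxE; apply: eq_bigr => k _; rewrite [LHS]mxE [RHS]mxE row_mxEl.
rewrite row_mxEr (ord1 j) mxE eqxx -l1; apply: eq_bigr => k _.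
by rewrite [RHS]mxE row_mxEr mxE l1 mulr1.
Qed.

Lemma hom_shift (F : fieldType) (n : nat) (x v : 'rV[F]_n) (t : F) :
  hom (x + t *: v) = hom x + t *: row_mx v 0.
Proof. by rewrite /hom scale_row_mx add_row_mx scaler0 addr0. Qed.

Lemma hom_line (F : fieldType) (n : nat) (x y : 'rV[F]_n) (t : F) :
  hom (x + t *: (y - x)) = hom x + t *: (hom y - hom x).
Proof.
by rewrite /hom opp_row_mx add_row_mx subrr scale_row_mx add_row_mx scaler0 addr0.
Qed.

Lemma ev_shift (F : fieldType) (n : nat) (h : 'cV[F]_(n + 1)) (x v : 'rV[F]_n) (t : F) :
  ev h (x + t *: v) = ev h x + t * lin h v.
Proof. by rewrite /ev hom_shift mulmxDl -scalemxAl [LHS]mxE [X in _ + X = _]mxE. Qed.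

Lemma ev_line (F : fieldType) (n : nat) (h : 'cV[F]_(n + 1)) (x y : 'rV[F]_n) (t : F) :
  ev h (x + t *: (y - x)) = ev h x + t * (ev h y - ev h x).
Proof. by rewrite /ev hom_line mulmxDl -scalemxAl mulmxBl [LHS]mxE [X in _ + X = _]mxE [X in _ + _ * X = _]mxE
  [X in _ + _ * (_ + X) = _]mxE. Qed.

Lemma ev_sum (F : fieldType) (n m : nat) (h : 'cV[F]_(n + 1))
    (p : 'I_m -> 'rV[F]_n) (l : 'I_m -> F) :
  \sum_(k < m) l k = 1 ->
  ev h (\sum_(k < m) l k *: p k) = \sum_(k < m) l k * ev h (p k).
Proof.
move=> l1; rewrite /ev hom_sum // mulmx_suml summxE.
by apply: eq_bigr => k _; rewrite -scalemxAl [LHS]mxE.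
Qed.

Lemma evD (F : fieldType) (n : nat) (g h : 'cV[F]_(n + 1)) (x : 'rV[F]_n) :
  ev (g + h) x = ev g x + ev h x.
Proof. by rewrite /ev mulmxDr [LHS]mxE. Qed.

Lemma evZ (F : fieldType) (n : nat) (a : F) (h : 'cV[F]_(n + 1)) (x : 'rV[F]_n) :
  ev (a *: h) x = a * ev h x.
Proof. by rewrite /ev -scalemxAr [LHS]mxE. Qed.

Lemma evN (F : fieldType) (n : nat) (h : 'cV[F]_(n + 1)) (x : 'rV[F]_n) :
  ev (- h) x = - ev h x.
Proof. by rewrite /ev mulmxN [LHS]mxE. Qed.

Lemma evE (F : fieldType) (n : nat) (h : 'cV[F]_(n + 1)) (x : 'rV[F]_n) :
  ev h x = \sum_(i < n) h (lshift 1 i) 0 * x 0 i + h (rshift n 0) 0.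
Proof.
rewrite /ev mxE big_split_ord /= big_ord1 row_mxEr mxE eqxx mulr1n mul1r; congr (_ + _).
by apply: eq_bigr => i _; rewrite row_mxEl mulrC.
Qed.

Lemma linE (F : fieldType) (n : nat) (h : 'cV[F]_(n + 1)) (v : 'rV[F]_n) :
  lin h v = \sum_(i < n) h (lshift 1 i) 0 * v 0 i.
Proof.
rewrite /lin mxE big_split_ord /= big_ord1 row_mxEr mxE mul0r addr0.
by apply: eq_bigr => i _; rewrite row_mxEl mulrC.
Qed.

(** * Rational bases for spans of integer points *)

Lemma hom_ratr (R : realType) (n : nat) (x : 'rV[rat]_n) :
  map_mx (ratr : rat -> R) (hom x) = hom (map_mx ratr x).
Proof. by rewrite /hom map_row_mx map_mx1. Qed.

Lemma int_pt_rat (R : realType) (n : nat) (x : 'rV[R]_n) :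
  is_int_pt x -> exists q : 'rV[rat]_n, x = map_mx ratr q.
Proof.
move=> xi; exists (\row_i (Num.floor (x 0 i))%:~R); apply/rowP => i.
by rewrite !mxE ratr_int floorK.
Qed.

Lemma lin_ratr (R : realType) (n : nat) (h : 'cV[rat]_(n + 1)) (v : 'rV[rat]_n) :
  lin (map_mx ratr h) (map_mx ratr v) = ratr (lin h v) :> R.
Proof. by rewrite /lin -[0](map_mx0 (ratr : rat -> R)) -map_row_mx -map_mxM [LHS]mxE. Qed.

(** If no independent family from [T] spanned [T] over the reals, every such family could be
    extended, since a vector outside the real span of [M] is outside its rational span as well. This
    would give m + 1 independent rows of length m. *)
Lemma rat_span (R : realType) (m : nat) (T : 'rV[R]_m -> Prop) :
  (forall t, T t -> exists q : 'rV[rat]_m, t = map_mx ratr q) ->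
  exists r (M : 'M[rat]_(r, m)), row_free M /\
    (forall k, T (map_mx ratr (row k M))) /\
    (forall t, T t -> (t <= map_mx ratr M)%MS).
Proof.
move=> Trat; apply/not_existsP => nospan.
suff indep r : exists M : 'M[rat]_(r, m), row_free M /\
    (forall k, T (map_mx ratr (row k M))).
  have [M [Mfree _]] := indep m.+1.
  by move: Mfree; rewrite /row_free => /eqP Mr; have := rank_leq_col M; rewrite Mr ltnn.
elim: r => [|r [M [Mfree MT]]].
  by exists 0; split; [rewrite /row_free mxrank0 | case].
have [t [Tt tM]] : exists t, T t /\ ~~ (t <= map_mx ratr M)%MS.
  apply: contrapT => nt; apply: (nospan r); exists M; split=> //; split=> // t Tt.
  by apply: contrapT => /negP tM; apply: nt; exists t.
have [q qt] := Trat t Tt.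
have qM : ~~ (q <= M)%MS by move: tM; rewrite qt map_submx.
rewrite -[r.+1]addn1.
exists (col_mx M q); split.
  rewrite /row_free eqn_leq rank_leq_row /=.
  rewrite -addsmxE addn1 -{1}(eqP Mfree) ltn_neqAle (mxrankS (addsmxSl _ _)) andbT.
  rewrite (mxrank_leqif_sup (addsmxSl _ _)).
  by rewrite addsmx_sub submx_refl.
move=> k; rewrite -(splitK k); case: (split k) => j /=.
  by rewrite rowKu.
rewrite rowKd; have -> : row j q = q by apply/rowP => i; rewrite mxE (ord1 j).
by rewrite -qt.
Qed.

Lemma int_span (R : realType) (n : nat) (S : 'rV[R]_n -> Prop) :
  (forall x, S x -> is_int_pt x) ->
  exists r (M : 'M[rat]_(r, n + 1)), row_free M /\
    (forall k, exists2 p, S p & map_mx ratr (row k M) = hom p) /\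
    (forall p, S p -> (hom p <= map_mx ratr M)%MS).
Proof.
move=> Sint.
have [|r [M [Mfree [MT TM]]]] := @rat_span R (n + 1) (fun t => exists2 p, S p & t = hom p).
  move=> t [p Sp ->]; have [q ->] := int_pt_rat _ _ _ (Sint p Sp).
  by exists (hom q); rewrite hom_ratr.
exists r, M; split=> //; split=> [k|p Sp]; last by apply: TM; exists p.
by have [p Sp pk] := MT k; exists p.
Qed.

Lemma hom_inj (F : fieldType) (n : nat) : injective (@hom F n).
Proof. by move=> x y /eq_row_mx []. Qed.

(** The last coordinate of [hom x] is 1, which forces the coefficients of any linear combination of
    the rows to sum to 1. *)
Lemma aff_spanP (R : realType) (n : nat) (S : 'rV[R]_n -> Prop) r (M : 'M[rat]_(r, n + 1)) :
  (forall k, exists2 p, S p & map_mx ratr (row k M) = hom p) ->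
  (forall p, S p -> (hom p <= map_mx (ratr : rat -> R) M)%MS) ->
  forall x, aff S x <-> (hom x <= map_mx ratr M)%MS.
Proof.
move=> MS SM x; split=> [[m [p [l [Sp [l1 ->]]]]]|/submxP [u xu]].
  by rewrite hom_sum //; apply: summx_sub => k _; apply: scalemx_sub; apply: SM.
have /choice [p pP] : forall k, exists p, S p /\ map_mx ratr (row k M) = hom p.
  by move=> k; have [q] := MS k; exists q.
have xE : hom x = \sum_(k < r) u 0 k *: hom (p k).
  rewrite xu mulmx_sum_row; apply: eq_bigr => k _.
  by rewrite -map_row (pP k).2.
have u1 : \sum_(k < r) u 0 k = 1.
  have -> : 1 = hom x 0 (rshift n 0) by rewrite row_mxEr mxE.
  rewrite xE summxE; apply: eq_bigr => k _.
  by rewrite [RHS]mxE row_mxEr mxE mulr1.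
exists r, p, (fun k => u 0 k); split; first by move=> k; case: (pP k).
split=> //; apply: (@hom_inj R n); by rewrite hom_sum.
Qed.

(** * CG closures along a segment *)

Lemma dotp_shift (R : realType) (n : nat) (c x v : 'rV[R]_n) (t : R) :
  dotp c (x + t *: v) = dotp c x + t * dotp c v.
Proof.
rewrite /dotp mulr_sumr -big_split /=; apply: eq_bigr => i _.
by rewrite !mxE mulrDr mulrCA.
Qed.

Lemma dotp_sum (R : realType) (n m : nat) (c : 'rV[R]_n) (p : 'I_m -> 'rV[R]_n)
    (l : 'I_m -> R) :
  dotp c (\sum_(k < m) l k *: p k) = \sum_(k < m) l k * dotp c (p k).
Proof.
rewrite /dotp; under [RHS]eq_bigr do rewrite mulr_sumr.
rewrite exchange_big; apply: eq_bigr => i _.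
by rewrite summxE mulr_sumr; apply: eq_bigr => k _; rewrite mxE mulrCA.
Qed.

Lemma dotp_int (R : realType) (n : nat) (c : 'rV[int]_n) (x : 'rV[R]_n) :
  is_int_pt x -> dotp (map_mx intr c) x \is a Num.int.
Proof. by move=> xi; apply: rpred_sum => i _; rewrite rpredM // mxE intr_int. Qed.

Lemma conv_le (R : realType) (m : nat) (l f : 'I_m -> R) (d : R) :
  (forall k, 0 <= l k) -> \sum_(k < m) l k = 1 -> (forall k, f k <= d) ->
  \sum_(k < m) l k * f k <= d.
Proof.
move=> l0 l1 fd; rewrite -[d]mul1r -l1 mulr_suml.
by apply: ler_sum => k _; apply: ler_wpM2l.
Qed.

(* A cut c with c v <= 0 cannot separate x + t v since x is in the hull of S;
   otherwise c v >= 1 and validity at x + (t + 1) v leaves a unit of slack. *)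
Lemma cg_iter_segment (R : realType) (n : nat) (Q S : 'rV[R]_n -> Prop)
    (x v : 'rV[R]_n) (k j : nat) :
  (forall p, S p -> is_int_pt p) -> (forall p, S p -> Q p) ->
  conv S x -> is_int_pt v ->
  (forall t, 0 <= t -> t <= (k + j)%:R -> Q (x + t *: v)) ->
  (forall p, S p -> cg_iter j Q p) /\
  (forall t, 0 <= t -> t <= k%:R -> cg_iter j Q (x + t *: v)).
Proof.
move=> Sint SQ [m [p [l [Sp [l0 [l1 xE]]]]]] vint.
elim: j k => [|j IH] k Qx; first by rewrite addn0 in Qx; split.
(* The induction hypothesis is used with one extra unit of length, which the outermost closure
   consumes. *)
have [SQj Qjx] := IH k.+1 ltac:(by rewrite addSnnS).
(* At an integer point [c] takes an integer value at most [d], so rounding [d] down does not cut it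
   off. *)
have Sfloor c d : (forall y, cg_iter j Q y -> dotp (map_mx intr c) y <= d) ->
    forall q, S q -> dotp (map_mx intr c) q <= (Num.floor d)%:~R.
  move=> cd q Sq; have /intrP [z zE] := dotp_int _ _ c q (Sint q Sq).
  by rewrite zE ler_int floor_ge_int -zE; apply/cd/SQj.
split=> [q Sq|t t0 tk].
  by split; [exact: SQj | move=> c d /Sfloor; apply].
split; first by apply: Qjx => //; rewrite -natr1; lra.
move=> c d cd; rewrite dotp_shift.
have /intrP [z zE] := dotp_int _ _ c v vint.
have [z0|z0] := leP z 0.
  have xd : dotp (map_mx intr c) x <= (Num.floor d)%:~R.
    by rewrite xE dotp_sum; apply: conv_le => // i; apply: Sfloor cd _ (Sp i).
  have tz : t * z%:~R <= 0 by rewrite mulr_ge0_le0 // lerz0.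
  by rewrite zE; lra.
have := cd (x + (t + 1) *: v) _; rewrite dotp_shift zE => dle.
have {}dle : dotp (map_mx intr c) x + (t + 1) * z%:~R <= d.
  by apply: dle; apply: Qjx; rewrite -?natr1; lra.
have z1 : 1 <= z%:~R :> R by rewrite ler1z.
have := floorD1_gt d; rewrite intrD; nra.
Qed.

(** * Primitive integer vectors *)

(** Here [d] is the gcd of the entries, [v] the Bezout coefficients and [e] the cofactors. The
    cofactors are kept explicit because they form the primitive vector wanted next. *)
Lemma int_bezout (n : nat) (c : 'I_n -> int) :
  exists d (e v : 'I_n -> int), (forall i, c i = e i * d) /\ \sum_(i < n) c i * v i = d.
Proof.
elim: n c => [|n IH] c; first by exists 0, c, c; split; [case | rewrite big_ord0].
have [d [e [v [ce cv]]]] := IH (fun i => c (lift ord0 i)).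
have [u [w uw]] := Bezoutz (c ord0) d.
have /dvdzP [e0 ce0] := dvdz_gcdl (c ord0) d.
have /dvdzP [e1 ce1] := dvdz_gcdr (c ord0) d.
exists (gcdz (c ord0) d).
exists (fun i => if unlift ord0 i is Some j then e j * e1 else e0).
exists (fun i => if unlift ord0 i is Some j then w * v j else u); split=> [i|].
  by case: unliftP => [j|] -> //; rewrite ce {1}ce1 mulrA.
rewrite big_ord_recl unlift_none -[RHS]uw; congr (_ + _); first exact: mulrC.
by rewrite -cv mulr_sumr; apply: eq_bigr => i _; rewrite liftK mulrCA.
Qed.

(** Clear denominators with [D], then divide by the gcd [d] of the resulting integers, which is
    nonzero because some [c i] is. The vector [v] will serve as the direction leading out of
    aff(P). *)
Lemma primitive_multiple (n : nat) (c : 'I_n -> rat) :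
  (exists i, c i != 0) ->
  exists a (e v : 'I_n -> int),
    (forall i, a * c i = (e i)%:~R) /\ \sum_(i < n) e i * v i = 1.
Proof.
move=> [i0 ci0]; pose D := \prod_(i < n) denq (c i).
have D0 : D != 0 by apply/prodf_neq0 => i _; exact: denq_neq0.
pose b i := numq (c i) * \prod_(j < n | j != i) denq (c j).
have bE i : (b i)%:~R = D%:~R * c i.
  by rewrite /b /D [X in X%:~R * _](bigD1 i) //= !rmorphM /= numqE; ring.
have [d [e [v [be bv]]]] := int_bezout n b.
have d0 : d != 0.
  apply: contraNneq ci0 => d0; have := bE i0; rewrite be d0 mulr0 => /esym/eqP.
  by rewrite mulf_eq0 intr_eq0 (negbTE D0).
have dQ : d%:~R != 0 :> rat by rewrite intr_eq0.
exists (D%:~R / d%:~R), e, v; split=> [i|].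
  by rewrite mulrAC -bE be intrM mulfK.
apply: (mulIf d0); rewrite mul1r -[in RHS]bv mulr_suml.
by apply: eq_bigr => i _; rewrite be mulrAC.
Qed.

(** * Slack of strict inequalities and the relative interior *)

(** With the division cleared, the condition [d i <= N * - u i] only gets weaker as N grows, so
    bounds for single elements can be added. The factor is taken as 1/N so that it is rational and
    can enter the description of a rational polyhedron. *)
Lemma uniform_slack (R : realType) (T : eqType) (s : seq T) (u d : T -> R) :
  (forall i, i \in s -> u i < 0) ->
  exists2 N : nat, (0 < N)%N & forall i, i \in s -> u i + N%:R^-1 * d i <= 0.
Proof.
move=> us.
suff [N N0 HN] : exists2 N : nat, (0 < N)%N & forall i, i \in s -> d i <= N%:R * - u i.
  exists N => // i /HN; have NR : 0 < N%:R :> R by rewrite ltr0n.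
  by rewrite mulrC -ler_pdivrMr // mulrC lerNr -subr_le0 opprK addrC.
elim: s us => [|h s IH] us; first by exists 1.
have [N N0 HN] := IH (fun i si => us i ltac:(by rewrite inE si orbT)).
have uh : 0 < - u h by rewrite oppr_gt0 us // mem_head.
exists (N + Num.bound (`|d h / u h|))%N; first by rewrite addn_gt0 N0.
move=> i; rewrite inE => /predU1P [->|si].
  rewrite -ler_pdivrMr // natrD; apply: ler_wpDl => //.
  rewrite invrN mulrN; apply: le_trans (ltW (archi_boundP (normr_ge0 _))).
  by rewrite -normrN ler_norm.
apply: le_trans (HN i si) _; apply: ler_wpM2r; last by rewrite ler_nat leq_addr.
by rewrite oppr_ge0 ltW // us // inE si orbT.
Qed.

(** Changing every coordinate by less than 1/N moves [ev h] by at most 1/N times the sum of the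
    absolute values of its linear coefficients; one N absorbs this for all [h] in [s]. *)
Lemma relint_slack (R : realType) (n : nat) (P : 'rV[R]_n -> Prop)
    (s : seq 'cV[R]_(n + 1)) (x : 'rV[R]_n) :
  (forall y, aff P y -> (forall h, h \in s -> ev h y <= 0) -> P y) ->
  aff P x -> (forall h, h \in s -> ev h x < 0) -> relint P x.
Proof.
move=> sP Px xs; split; first by apply: sP => // h /xs /ltW.
pose d (h : 'cV[R]_(n + 1)) := \sum_(i < n) `|h (lshift 1 i) 0|.
have [N N0 HN] := uniform_slack R _ s (fun h => ev h x) d xs.
have NR : 0 < N%:R^-1 :> R by rewrite invr_gt0 ltr0n.
exists N%:R^-1; split=> // y Py yx; apply: sP => // h hs.
apply: le_trans (HN h hs).
rewrite !evE -addrA [X in _ <= _ + X]addrC addrA lerD2r /d mulr_sumr -big_split /=.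
apply: ler_sum => i _; rewrite -lerBlDl -mulrBr [leRHS]mulrC.
apply: le_trans (ler_norm _) _; rewrite normrM; apply: ler_wpM2l => //.
exact/ltW/yx.
Qed.

(** * Rationality of the affine hull and of the facets *)

Lemma sub_aff (R : realType) (n : nat) (P : 'rV[R]_n -> Prop) (x : 'rV[R]_n) :
  P x -> aff P x.
Proof.
by move=> Px; exists 1, (fun=> x), (fun=> 1); rewrite !big_ord1 scale1r.
Qed.

(** Every point of P is a convex combination of integer points of P, so these already span aff(P)
    and a rational basis can be drawn from them. *)
Lemma aff_rational (R : realType) (n : nat) (P : 'rV[R]_n -> Prop) :
  (forall x, P x -> int_hull P x) ->
  exists r (M : 'M[rat]_(r, n + 1)), row_free M /\
    (forall k, exists2 p, P p & map_mx ratr (row k M) = hom p) /\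
    (forall x, aff P x <-> (hom x <= map_mx (ratr : rat -> R) M)%MS).
Proof.
move=> Phull; pose S (x : 'rV[R]_n) := P x /\ is_int_pt x.
have [r [M [Mfree [rowS SM]]]] := int_span R n S (fun x Sx => Sx.2).
exists r, M; split=> //; split=> [k|x].
  by have [p [Pp _] pE] := rowS k; exists p.
split=> [[m [y [l [Py [l1 ->]]]]]|].
  rewrite hom_sum //; apply: summx_sub => k _; apply: scalemx_sub.
  have [m' [y' [l' [Sy' [_ [l'1 ->]]]]]] := Phull _ (Py k).
  by rewrite hom_sum //; apply: summx_sub => k' _; apply/scalemx_sub/SM.
move/(aff_spanP R n S _ M rowS SM x) => [m [y [l [Sy xE]]]].
by exists m, y, l; split=> // k; case: (Sy k).
Qed.

Lemma ev_col (F : fieldType) (n m : nat) (B : 'M[F]_(n + 1, m)) (x : 'rV[F]_n) i :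
  ev (col i B) x = (hom x *m B) 0 i.
Proof. by rewrite /ev colE mulmxA -colE mxE. Qed.

(** The point [z] lies on the facet [g = 0] and is strict for all other inequalities. The integer
    points of that facet span the whole hyperplane [g = 0] of aff(P), so a rational functional
    vanishing on them, with the right sign at one further integer point, is a positive multiple of
    [g] on aff(P). *)
Lemma facet_rational (R : realType) (n : nat) (P : 'rV[R]_n -> Prop)
    (G : seq 'cV[R]_(n + 1)) (g : 'cV[R]_(n + 1)) (z p : 'rV[R]_n) :
  (forall x, P x -> int_hull P x) ->
  (forall x, P x -> ev g x <= 0) ->
  (forall x, aff P x -> ev g x <= 0 -> (forall h, h \in G -> ev h x <= 0) -> P x) ->
  P z -> ev g z = 0 -> (forall h, h \in G -> ev h z < 0) ->
  P p -> ev g p < 0 ->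
  exists (q : 'cV[rat]_(n + 1)) (c : R), 0 < c /\
    forall x, aff P x -> ev (map_mx ratr q) x = c * ev g x.
Proof.
move=> Phull Pg GP Pz gz Gz Pp gp.
have [rS [MS [_ [_ affP]]]] := aff_rational R n P Phull.
pose T x := (P x /\ is_int_pt x) /\ ev g x = 0.
have [r [M [_ [rowT TM]]]] := int_span R n T (fun x Tx => Tx.1.2).
set MR := map_mx (ratr : rat -> R) M in TM.
have affS x : aff P x -> (hom x <= map_mx (ratr : rat -> R) MS)%MS by move/affP.
have affPP := sub_aff R n P.
(* All terms of the convex combination have [g <= 0], so a total of 0 leaves positive weight only on
   integer points with [g = 0]. *)
have facet_span w : P w -> ev g w = 0 -> (hom w <= MR)%MS.
  move=> Pw; have [m [y [l [Sy [l0 [l1 ->]]]]]] := Phull _ Pw.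
  rewrite ev_sum // => /eqP; rewrite -oppr_eq0 -sumrN psumr_eq0 => [/allP l_g|k _].
    rewrite hom_sum //; apply: summx_sub => k _.
    have := l_g k (mem_index_enum k); rewrite /= oppr_eq0 mulf_eq0.
    case/orP => /eqP lg; first by rewrite lg scale0r sub0mx.
    by apply/scalemx_sub/TM; split.
  by rewrite -mulrN mulr_ge0 // oppr_ge0 Pg //; case: (Sy k).
(* A step of 1/N from [z] towards [w] stays in P, hence in the facet; scaling it up by N recovers
   [w]. *)
have tight_span w : aff P w -> ev g w = 0 -> (hom w <= MR)%MS.
  move=> Aw gw.
  have [N N0 HN] := uniform_slack R _ G (fun h => ev h z) (fun h => ev h w - ev h z) Gz.
  have NR : N%:R^-1 != 0 :> R by rewrite invr_eq0 pnatr_eq0 -lt0n.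
  have zw : (hom (z + N%:R^-1 *: (w - z)) <= MR)%MS.
    apply: facet_span; last by rewrite ev_line gz gw subrr mulr0 addr0.
    apply: GP => [||h hG].
    - apply/affP; rewrite hom_line addmx_sub ?scalemx_sub ?addmx_sub //; try exact: affS.
        by apply/affS/affPP.
      by rewrite eqmx_opp; apply/affS/affPP.
    - by rewrite ev_line gz gw subrr mulr0 addr0.
    - by rewrite ev_line HN.
  have -> : hom w = hom z + N%:R *: (hom (z + N%:R^-1 *: (w - z)) - hom z).
    rewrite hom_line [X in _ *: X]addrAC subrr add0r scalerA divff ?scale1r.
      by rewrite addrC subrK.
    by move: NR; rewrite invr_eq0.
  have zM := facet_span z Pz gz.
  by rewrite addmx_sub // scalemx_sub // addmx_sub // eqmx_opp.
have [s Ss gs] : exists2 s, P s /\ is_int_pt s & ev g s < 0.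
  apply: contrapT => nos; move: gp; apply/negP; rewrite -leNgt.
  have [m [y [l [Sy [l0 [l1 ->]]]]]] := Phull _ Pp.
  rewrite ev_sum //; apply: sumr_ge0 => k _; apply: mulr_ge0 => //.
  by rewrite leNgt; apply/negP => gy; apply: nos; exists (y k).
have [sq sE] := int_pt_rat R n s Ss.2.
have MRg : MR *m g = 0.
  apply/row_matrixP => k; rewrite row_mul row0 -map_row.
  have [t [_ gt] ->] := rowT k.
  by apply/matrixP => a b; rewrite !ord1 [RHS]mxE.
(* [g] vanishes on the rows of [M] but not at [s], so some column of the cokernel of [M] is nonzero
   at [s]. *)
have sM : ~~ (hom sq <= M)%MS.
  rewrite -(map_submx (ratr : {rmorphism rat -> R})) hom_ratr -sE.
  apply/negP => /submxP [D sD]; move: gs.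
  by rewrite /ev sD -mulmxA MRg mulmx0 mxE ltxx.
have [i si] : exists i, ev (col i (cokermx M)) sq != 0.
  apply/existsP; move: sM; apply: contraR; rewrite negb_exists => /forallP s0.
  by rewrite submxE; apply/eqP/rowP => i; have /negPn/eqP := s0 i; rewrite ev_col => ->; rewrite mxE.
(* With this factor the value of [q] at [s] is minus a nonzero square, hence negative like that of
   [g]. *)
pose q := - ev (col i (cokermx M)) sq *: col i (cokermx M).
have qs : ev (map_mx ratr q) s < 0.
  have -> : ev (map_mx ratr q) s = ratr (ev q sq) :> R.
    by rewrite sE /ev -hom_ratr -map_mxM [LHS]mxE.
  rewrite ltrq0 /q evZ mulNr oppr_lt0 -expr2.
  by rewrite exprn_even_gt0.
have qM w : (hom w <= MR)%MS -> ev (map_mx ratr q) w = 0.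
  move=> /submxP [D wD]; rewrite /ev wD -mulmxA -map_mxM /q -scalemxAr colE mulmxA.
  by rewrite mulmx_coker mul0mx scaler0 map_mx0 mulmx0 mxE.
exists q, (ev (map_mx ratr q) s / ev g s); split.
  by rewrite ltr_ndivlMr // mul0r.
move=> x Ax.
(* Subtracting [a] times [s - z] brings [x] to the hyperplane [g = 0], where [q] vanishes; this
   yields [q(x) = a q(s)]. *)
pose a := ev g x / ev g s.
have gs0 : ev g s != 0 by rewrite lt_eqF.
pose w := x + (- a) *: (s - z).
have linB h : lin h (s - z) = ev h s - ev h z.
  have -> : ev h s = ev h z + lin h (s - z).
    by rewrite -[lin _ _]mul1r -ev_shift scale1r addrC subrK.
  by rewrite addrAC subrr add0r.
have gw : ev g w = 0.
  by rewrite /w ev_shift linB gz subr0 mulNr divfK // subrr.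
have Aw : aff P w.
  apply/affP.
  have -> : hom w = hom x - a *: (hom s - hom z).
    rewrite /w hom_shift scaleNr; congr (_ - _ *: _).
    by rewrite /hom opp_row_mx add_row_mx subrr.
  rewrite addmx_sub ?eqmx_opp ?scalemx_sub ?addmx_sub //; try exact: affS.
    by apply/affS/affPP; case: Ss.
  by rewrite eqmx_opp; apply/affS/affPP.
have := qM _ (tight_span w Aw gw).
rewrite /w ev_shift linB (qM _ (facet_span z Pz gz)) subr0 mulNr => /eqP.
by rewrite subr_eq0 => /eqP ->; rewrite /a [RHS]mulrAC mulrC mulrA.
Qed.

(** * A rational description of P inside its affine hull *)

Lemma ev_aff_eq0 (R : realType) (n : nat) (P : 'rV[R]_n -> Prop)
    (h : 'cV[R]_(n + 1)) (x : 'rV[R]_n) :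
  (forall y, P y -> ev h y = 0) -> aff P x -> ev h x = 0.
Proof.
move=> h0 [m [p [l [Pp [l1 ->]]]]]; rewrite ev_sum // big1 // => k _.
by rewrite h0 // mulr0.
Qed.

Lemma polyhedron_ev (R : realType) (n : nat) (P : 'rV[R]_n -> Prop) :
  is_polyhedron P ->
  exists m (G : 'I_m -> 'cV[R]_(n + 1)), forall x, P x <-> forall j, ev (G j) x <= 0.
Proof.
move=> [m [A [b PAb]]].
exists m, (fun j => col_mx (row j A)^T (- b j 0)%:M) => x; rewrite PAb.
suff GE j : ev (col_mx (row j A)^T (- b j 0)%:M) x = \sum_(i < n) A j i * x 0 i - b j 0.
  by split=> H j; have := H j; rewrite GE subr_le0.
rewrite evE col_mxEd mxE mulr1n; congr (_ + _).
by apply: eq_bigr => i _; rewrite col_mxEu !mxE.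
Qed.

(** A midpoint of two points of P is strict wherever at least one of them is. *)
Lemma strict_point (R : realType) (n m : nat) (P : 'rV[R]_n -> Prop)
    (G : 'I_m -> 'cV[R]_(n + 1)) (s : seq 'I_m) :
  (forall x, P x <-> forall j, ev (G j) x <= 0) ->
  (exists x, P x) ->
  (forall j, j \in s -> exists2 x, P x & ev (G j) x < 0) ->
  exists2 x, P x & forall j, j \in s -> ev (G j) x < 0.
Proof.
move=> PG [x0 Px0]; elim: s => [|i s IH] sx; first by exists x0.
have [y Py ys] := IH (fun j sj => sx j ltac:(by rewrite inE sj orbT)).
have [x Px xi] := sx i (mem_head _ _).
have mid j : ev (G j) (x + 2^-1 *: (y - x)) = (ev (G j) x + ev (G j) y) / 2.
  by rewrite ev_line; field.
exists (x + 2^-1 *: (y - x)).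
  apply/PG => j; rewrite mid.
  by have := (PG x).1 Px j; have := (PG y).1 Py j; lra.
move=> j; rewrite inE mid => /predU1P [->|/ys yj].
  by have := (PG y).1 Py i; lra.
by have := (PG x).1 Px j; lra.
Qed.

(* Over a minimal subsystem J each inequality defines a facet: the segment from
   a strict point to a point violating only inequality i crosses it there. *)
Lemma rational_description (R : realType) (n : nat) (P : 'rV[R]_n -> Prop) :
  is_integral_polyhedron P -> (exists x, P x) ->
  exists s : seq 'cV[rat]_(n + 1),
    (forall x, P x -> forall h, h \in s -> ev (map_mx ratr h) x <= 0) /\
    (forall x, aff P x -> (forall h, h \in s -> ev (map_mx ratr h) x <= 0) -> P x) /\
    (exists2 x, P x & forall h, h \in s -> ev (map_mx ratr h) x < 0).
Proof.
move=> [/polyhedron_ev [m [G PG]] Phull] Pne.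
(* The subsystem has to describe P only within aff(P), so a minimal one contains no inequality that
   is tight on all of P. *)
pose desc (J : {set 'I_m}) :=
  `[< forall x, aff P x -> (forall j, j \in J -> ev (G j) x <= 0) -> P x >].
have [|J /minsetP [/asboolP JP Jmin] _] := @minset_exists _ desc setT.
  by apply/asboolP => x _ Gx; apply/PG => j; apply: Gx; rewrite inE.
have viol i : i \in J -> exists y, [/\ aff P y,
    forall j, j \in J :\ i -> ev (G j) y <= 0 & 0 < ev (G i) y].
  move=> iJ; have : ~~ desc (J :\ i).
    apply/negP => /Jmin /(_ (subD1set _ _)) E.
    by move: iJ; rewrite -E !inE eqxx.
  move=> /asboolPn /existsNP [y /not_implyP [Ay /not_implyP [Gy nPy]]].
  exists y; split=> //; rewrite ltNge; apply/negP => yi; apply: nPy; apply: JP => // j jJ.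
  by have [->//|ji] := eqVneq j i; apply: Gy; rewrite !inE ji.
(* Otherwise [G i] would vanish on P and therefore on aff(P), against the violating point [y]. *)
have strict i : i \in J -> exists2 x, P x & ev (G i) x < 0.
  move=> /viol [y [Ay _ yi]]; apply: contrapT => nox.
  move: yi; rewrite (ev_aff_eq0 R n P (G i) y _ Ay) ?ltxx // => x Px.
  apply/eqP; rewrite eq_le (PG x).1 //= leNgt; apply/negP => xi.
  by apply: nox; exists x.
have [x Px xJ] : exists2 x, P x & forall j, j \in enum J -> ev (G j) x < 0.
  by apply: strict_point => // j; rewrite mem_enum; apply: strict.
have facet i : i \in J -> exists q : 'cV[rat]_(n + 1), exists2 c : R, 0 < c &
    forall x, aff P x -> ev (map_mx ratr q) x = c * ev (G i) x.
  move=> iJ; have [y [Ay yJ yi]] := viol i iJ.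
  have xi : ev (G i) x < 0 by apply: xJ; rewrite mem_enum.
  pose t := - ev (G i) x / (ev (G i) y - ev (G i) x).
  have den : 0 < ev (G i) y - ev (G i) x by lra.
  have t0 : 0 < t by rewrite divr_gt0 // oppr_gt0.
  have t1 : t < 1 by rewrite ltr_pdivrMr //; lra.
  pose z := x + t *: (y - x).
  have zi : ev (G i) z = 0.
    by rewrite ev_line /t divfK ?gt_eqF // subrr.
  have zJ j : j \in J :\ i -> ev (G j) z < 0.
    move=> jJ; have jx : ev (G j) x < 0.
      by apply: xJ; rewrite mem_enum; case/setD1P: jJ.
    by rewrite ev_line; have := yJ j jJ; nra.
  have JPz w : aff P w -> ev (G i) w <= 0 ->
      (forall h, h \in [seq G j | j <- enum (J :\ i)] -> ev h w <= 0) -> P w.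
    move=> Aw wi wJ; apply: JP => // j jJ; have [->//|ji] := eqVneq j i.
    by apply: wJ; apply: map_f; rewrite mem_enum !inE ji.
  have Gz h : h \in [seq G j | j <- enum (J :\ i)] -> ev h z < 0.
    by move=> /mapP [j]; rewrite mem_enum => jJ ->; apply: zJ.
  (* Concatenate the affine combinations for [x] and [y], with weights scaled by 1 - t and t. *)
  have Az : aff P z.
    have [m1 [p1 [l1 [Pp1 [s1 xE]]]]] := sub_aff R n P x Px.
    have [m2 [p2 [l2 [Pp2 [s2 yE]]]]] := Ay.
    exists (m1 + m2)%N, (fun k => match split k with inl a => p1 a | inr b => p2 b end).
    exists (fun k => match split k with inl a => (1 - t) * l1 a | inr b => t * l2 b end).
    split; first by move=> k; case: (split k).
    have splitl a : split (lshift m2 a) = inl a :> 'I_m1 + 'I_m2.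
      by rewrite -[lshift m2 a]/(unsplit (inl a)) unsplitK.
    have splitr b : split (rshift m1 b) = inr b :> 'I_m1 + 'I_m2.
      by rewrite -[rshift m1 b]/(unsplit (inr b)) unsplitK.
    rewrite !big_split_ord /=; split.
      under eq_bigr do rewrite splitl; under [X in _ + X]eq_bigr do rewrite splitr.
      by rewrite -!mulr_sumr s1 s2; lra.
    under eq_bigr do rewrite splitl -scalerA.
    under [X in _ + X]eq_bigr do rewrite splitr -scalerA.
    by rewrite -!scaler_sumr -xE -yE /z scalerBr scalerBl scale1r addrA addrAC.
  have Pz : P z by apply: JPz => // [|h hG]; [rewrite zi | apply/ltW/Gz].
  have [q [c [c0 qc]]] := facet_rational R n P _ (G i) z x
    (fun w => (Phull w).1) (fun w Pw => (PG w).1 Pw i) JPz Pz zi Gz Px xi.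
  by exists q, c.
have /choice [q qP] : forall i, exists q : 'cV[rat]_(n + 1), i \in J ->
    exists2 c : R, 0 < c & forall x, aff P x -> ev (map_mx ratr q) x = c * ev (G i) x.
  by move=> i; have [/facet [q qi]|] := boolP (i \in J); [exists q | exists 0].
exists [seq q i | i <- enum J]; split; [|split].
- move=> w Pw _ /mapP [i + ->]; rewrite mem_enum => iJ.
  have [c c0 ->] := qP i iJ; last exact: sub_aff.
  by apply: mulr_ge0_le0; [apply: ltW | apply: (PG w).1].
- move=> w Aw wJ; apply: JP => // i iJ; have [c c0 qc] := qP i iJ.
  have := wJ (q i) ltac:(by apply: map_f; rewrite mem_enum).
  by rewrite qc // pmulr_rle0.
- exists x => // _ /mapP [i iJ ->]; have [|c c0 ->] := qP i.
  - by rewrite -mem_enum.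
  - by rewrite pmulr_rlt0 // xJ.
  - exact: sub_aff.
Qed.

(** * A functional and a direction transversal to aff(P) *)

(** The columns of the cokernel of a rational basis give equations for aff(P); each is written as
    two opposite inequalities. *)
Lemma aff_inequalities (R : realType) (n : nat) (P : 'rV[R]_n -> Prop) :
  (forall x, P x -> int_hull P x) ->
  exists s : seq 'cV[rat]_(n + 1),
    forall x, aff P x <-> (forall h, h \in s -> ev (map_mx ratr h) x <= 0).
Proof.
move=> /(aff_rational R n P) [r [M [_ [_ affM]]]].
pose K i := col i (cokermx M).
exists ([seq K i | i <- enum 'I_(n + 1)] ++ [seq - K i | i <- enum 'I_(n + 1)]) => x.
have KE i : ev (map_mx ratr (K i)) x = (hom x *m cokermx (map_mx (ratr : rat -> R) M)) 0 i.
  by rewrite -map_cokermx -ev_col /K; congr (ev _ x); apply/colP => j; rewrite !mxE.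
rewrite affM submxE; split=> [/eqP x0 h|xs].
  rewrite mem_cat => /orP [] /mapP [i _ ->]; rewrite ?map_mxN ?evN KE x0 mxE //.
  by rewrite oppr0.
apply/eqP/rowP => i; rewrite [RHS]mxE -KE; apply/eqP; rewrite eq_le.
have iK : i \in enum 'I_(n + 1) by rewrite mem_enum.
apply/andP; split; first by apply: xs; rewrite mem_cat map_f.
rewrite -oppr_le0 -evN -map_mxN; apply: xs.
by rewrite mem_cat (map_f (fun i => - K i)) ?orbT.
Qed.

(** A nonzero rational functional vanishes on aff(P) because the dimension is below n. Scaling its
    linear part to a primitive integer vector provides [v] by Bezout, and an integer point of P
    forces the constant term to be an integer. *)
Lemma transversal (R : realType) (n : nat) (P : 'rV[R]_n -> Prop) :
  (forall x, P x -> int_hull P x) -> (exists x, P x) -> dim_lt_n P ->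
  exists (tau : 'cV[rat]_(n + 1)) (v : 'rV[rat]_n),
    (forall x, aff P x -> ev (map_mx ratr tau) x = 0) /\
    (forall y : 'rV[R]_n, is_int_pt y -> ev (map_mx ratr tau) y \is a Num.int) /\
    is_int_pt (map_mx ratr v : 'rV[R]_n) /\ lin tau v = 1.
Proof.
move=> Phull [x0 Px0] dimP.
have [r [M [Mfree [rowM affM]]]] := aff_rational R n P Phull.
(* A basis of full rank would consist of n + 1 affinely independent points of P. *)
have Mnfull : ~~ row_full M.
  apply/negP; rewrite /row_full (eqP Mfree) => /eqP rn.
  have {}rn : r = n.+1 by rewrite rn addn1.
  subst r; have /choice [p pP] : forall k, exists p, P p /\ map_mx ratr (row k M) = hom p.
    by move=> k; have [q] := rowM k; exists q.
  have := dimP p (fun k => (pP k).1); set D := \matrix_(i < n) _ => rD.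
  have [i wi] : exists i, col i (cokermx D) != 0.
    apply/existsP; move: rD; apply: contraTT; rewrite negb_exists => /forallP w0.
    suff /eqP : cokermx D = 0 by rewrite -mxrank_eq0 mxrank_coker subn_eq0 -leqNgt.
    apply/matrixP => a b; have /negPn/eqP/colP/(_ a) := w0 b.
    by rewrite [LHS]mxE [RHS]mxE => ->; rewrite mxE.
  (* [h] encodes the functional x -> (x - p_0) w. It vanishes at all the points [p k], so full rank
     would make it zero although [w] is not. *)
  pose w := col i (cokermx D); pose h := col_mx w (- (p ord0 *m w)).
  have Dw : D *m w = 0 by rewrite /w colE mulmxA mulmx_coker mul0mx.
  have hp k : hom (p k) *m h = 0.
    rewrite /hom /h mul_row_col mul1mx -mulmxBl.
    case: (unliftP ord0 k) => [j|] ->; last by rewrite subrr mul0mx.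
    by have := congr1 (row j) Dw; rewrite row_mul rowK row0.
  have Mh : map_mx ratr M *m h = 0.
    apply/row_matrixP => k; rewrite row_mul row0 -map_row (pP k).2.
    exact: hp.
  have /row_fullP [B BM] : row_full (map_mx (ratr : rat -> R) M).
    by rewrite /row_full mxrank_map (eqP Mfree) addn1.
  have h0 : h = 0 by rewrite -[h]mul1mx -BM -mulmxA Mh mulmx0.
  by move: wi; rewrite -/w -(col_mxKu w (- (p ord0 *m w))) -/h h0 linear0 eqxx.
have [i qi] : exists i, col i (cokermx M) != 0.
  apply/existsP; move: Mnfull; apply: contraR; rewrite negb_exists => /forallP w0.
  suff : cokermx M = 0.
    move=> /eqP; rewrite -mxrank_eq0 mxrank_coker subn_eq0 => nM.
    by rewrite /row_full eqn_leq rank_leq_col.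
  apply/matrixP => a b; have /negPn/eqP/colP/(_ a) := w0 b.
  by rewrite [LHS]mxE [RHS]mxE => ->; rewrite mxE.
set q := col i (cokermx M) in qi.
have q0 x : aff P x -> ev (map_mx ratr q) x = 0.
  move=> /affM /submxP [D xD]; rewrite /ev xD -mulmxA -map_mxM /q colE mulmxA.
  by rewrite mulmx_coker mul0mx map_mx0 mulmx0 mxE.
(* With zero linear part [q] would be constant, and its zero at [x0] would make it zero
   altogether. *)
have [j qj] : exists j, q (lshift 1 j) 0 != 0.
  apply/existsP; move: qi; apply: contraR; rewrite negb_exists => /forallP ql.
  have {}ql j : q (lshift 1 j) 0 = 0 by have /negPn/eqP := ql j.
  have := q0 x0 (sub_aff R n P x0 Px0).
  rewrite evE big1 => [|j _]; last by rewrite mxE ql rmorph0 mul0r.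
  rewrite add0r mxE => /eqP; rewrite fmorph_eq0 => /eqP qr.
  apply/eqP/colP => a; rewrite [RHS]mxE -[a]splitK.
  by case: (split a) => b; rewrite ?(ord1 b) [unsplit _]/=.
have [a [e [v [ae ev1]]]] := primitive_multiple n (fun j => q (lshift 1 j) 0)
  (ex_intro _ j qj).
have tau0 x : aff P x -> ev (map_mx ratr (a *: q)) x = 0.
  by move=> Ax; rewrite map_mxZ evZ q0 ?mulr0.
have tauE y : ev (map_mx (ratr : rat -> R) (a *: q)) y =
    \sum_(j < n) (e j)%:~R * y 0 j + ratr (a * q (rshift n 0) 0).
  rewrite evE; congr (_ + _); last by rewrite mxE mxE.
  by apply: eq_bigr => l _; rewrite mxE mxE ae ratr_int.
have dot_int y : is_int_pt y -> \sum_(j < n) (e j)%:~R * y 0 j \is a @Num.int R.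
  by move=> yint; apply: rpred_sum => l _; rewrite rpredM ?intr_int.
exists (a *: q), (\row_j (v j)%:~R); split=> //; split; [|split].
(* At an integer point of P the functional is 0 and its linear part is an integer, so its constant
   term is an integer. The convex combination is nonempty since its weights sum to 1. *)
- have [m [p [l [Pp [_ [l1 _]]]]]] := Phull _ Px0.
  have m0 : (0 < m)%N.
    by rewrite lt0n; apply/eqP => m0; subst m; move/eqP: l1; rewrite big_ord0 eq_sym oner_eq0.
  have [Pp0 p0int] := Pp (Ordinal m0).
  have := tau0 _ (sub_aff R n P _ Pp0); rewrite tauE => /eqP.
  rewrite addrC addr_eq0 => /eqP rE y yint.
  by rewrite tauE rE rpredB ?dot_int.
- by move=> l; rewrite !mxE ratr_int intr_int.
- rewrite linE -[RHS]/(1%:~R) -ev1 rmorph_sum; apply: eq_bigr => l _.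
  by rewrite rmorphM mxE ae mxE.
Qed.

(** * The sheared relaxation *)

Lemma rational_polyhedron_seq (R : realType) (n : nat) (s : seq 'cV[rat]_(n + 1)) :
  is_rational_polyhedron
    (fun x : 'rV[R]_n => forall h, h \in s -> ev (map_mx ratr h) x <= 0).
Proof.
exists (size s), (\matrix_(j, i) ratr (nth 0 s j (lshift 1 i) 0)).
exists (\col_j ratr (- nth 0 s j (rshift n 0) 0)).
split; first by move=> j i; rewrite mxE; eexists.
split; first by move=> j; rewrite mxE; eexists.
have E (x : 'rV[R]_n) (j : 'I_(size s)) : (\sum_(i < n)
    (\matrix_(j < size s, i < n) ratr (nth 0 s j (lshift 1 i) 0)) j i * x 0 i <=
    (\col_(j < size s) ratr (- nth 0 s j (rshift n 0) 0)) j 0) =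
    (ev (map_mx (ratr : rat -> R) (nth 0 s j)) x <= 0).
  rewrite mxE rmorphN /= -subr_le0 opprK evE mxE; congr (_ + _ <= 0).
  by apply: eq_bigr => i _; rewrite !mxE.
move=> x; split=> [sx j|sx h /(nthP 0) [j js <-]].
  by rewrite E; apply/sx/mem_nth.
by have := sx (Ordinal js); rewrite E.
Qed.

Theorem theorem2 (R : realType) (n : nat) (P : 'rV[R]_n -> Prop) :
  is_integral_polyhedron P ->
  (exists x, P x) ->
  dim_lt_n P ->
  (forall x, is_int_pt x -> ~ relint P x) ->
  forall k : nat, exists Q : 'rV[R]_n -> Prop,
    is_relaxation P Q /\ ~ (forall x, cg_iter k Q x -> aff P x).
Proof.
move=> Pint Pne dimP nointerior k.
have Phull x : P x -> int_hull P x := (Pint.2 x).1.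
have [s [Ps [sP [xb Pxb xbs]]]] := rational_description R n P Pint Pne.
have [es affes] := aff_inequalities R n P Phull.
have [tau [v [tau0 [tauint [vint tauv]]]]] := transversal R n P Phull Pne dimP.
set vR : 'rV[R]_n := map_mx ratr v in vint.
pose evR h (x : 'rV[R]_n) := ev (map_mx ratr h) x.
(* 1/N plays the role of eps: at [xb] every inequality has slack at least (k + 1)/N, enough for a
   ray of length k + 1. *)
have [N N0 HN] := uniform_slack R _ s (fun h => evR h xb) (fun=> (1 + k)%:R) xbs.
have NR : 0 < N%:R^-1 :> R by rewrite invr_gt0 ltr0n.
(* This is [h] pulled back along y -> y - tau(y) v, plus slope [c] in tau. The equations of aff(P)
   are taken with c = 0, the inequalities of P with c = 1/N. *)
pose shear (c : rat) h := h + (c - lin h v) *: tau.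
have shearE c h y : evR (shear c h) y =
    evR h (y - evR tau y *: vR) + ratr c * evR tau y.
  rewrite /evR /shear map_mxD map_mxZ evD evZ -scaleNr ev_shift lin_ratr rmorphB /=.
  by ring.
pose sQ := - tau :: [seq shear 0 h | h <- es] ++ [seq shear N%:R^-1 h | h <- s].
pose Q (y : 'rV[R]_n) := forall h, h \in sQ -> evR h y <= 0.
have QP y : Q y <-> [/\ 0 <= evR tau y, aff P (y - evR tau y *: vR) &
    forall h, h \in s -> evR h (y - evR tau y *: vR) + N%:R^-1 * evR tau y <= 0].
  have NE : ratr N%:R^-1 = N%:R^-1 :> R by rewrite fmorphV rmorph_nat.
  split=> [Qy|[t0 Ay ys] h].
    split.
    - by rewrite -oppr_le0 /evR -evN -map_mxN; apply: Qy; rewrite mem_head.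
    - apply/affes => h hes; have := Qy (shear 0 h).
      rewrite shearE rmorph0 mul0r addr0; apply.
      by rewrite inE mem_cat map_f ?orbT.
    - move=> h hs; rewrite -NE -shearE; apply: Qy.
      by rewrite inE mem_cat [X in _ || X]orbC map_f ?orbT.
  rewrite inE mem_cat => /or3P [/eqP ->|/mapP [g ges ->]|/mapP [g gs ->]].
  - by rewrite /evR map_mxN evN oppr_le0.
  - by rewrite shearE rmorph0 mul0r addr0; apply: (affes _).1 ges.
  - by rewrite shearE NE; apply: ys.
have tauR : lin (map_mx ratr tau) vR = 1 by rewrite lin_ratr tauv rmorph1.
have tau_ray x t : aff P x -> evR tau (x + t *: vR) = t.
  by move=> Ax; rewrite /evR ev_shift tau0 // tauR mulr1 add0r.
have PQ x : P x -> Q x.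
  move=> Px; have Ax := sub_aff R n P x Px.
  have t0 : evR tau x = 0 by apply: tau0.
  apply/QP; rewrite t0 scale0r subr0; split=> // h hs.
  by rewrite mulr0 addr0; apply: Ps.
have Qray t : 0 <= t -> t <= (1 + k)%:R -> Q (xb + t *: vR).
  move=> t0 tk; have Ax := sub_aff R n P xb Pxb.
  apply/QP; rewrite tau_ray // addrK; split=> // h hs.
  by apply: le_trans (HN h hs); rewrite lerD2l; apply: ler_wpM2l => //; apply: ltW.
exists Q; split.
  split; first exact: rational_polyhedron_seq.
  move=> y yint; split=> [/QP [t0 Ay ys]|/PQ //].
  move: t0; rewrite le_eqVlt => /predU1P [t0|tpos].
    move: Ay ys; rewrite -t0 scale0r subr0 => Ay ys; apply: sP => // h hs.
    by have := ys h hs; rewrite mulr0 addr0.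
  (* For tau(y) > 0 the projected point is integral, as tau(y) and [v] are, and each inequality of P
     has slack at least tau(y)/N there, so it lies in the relative interior. *)
  case: (nointerior (y - evR tau y *: vR)) => [i|].
    rewrite [X in X \is a _]mxE rpredD ?yint // mxE rpredN mxE.
    by apply: rpredM; [apply: tauint | apply: vint].
  apply: (relint_slack R n P (map (map_mx ratr) s)) => [x Ax xs|//|_ /mapP [h hs ->]].
    by apply: sP => // h hs; apply: xs; apply: map_f.
  have := ys h hs; rewrite /evR; have := mulr_gt0 NR tpos; rewrite /evR; lra.
move=> cgaff.
pose S p := P p /\ is_int_pt p.
(* Of the length k + 1 one unit remains after k closures, so [xb + v] survives; there tau is 1,
   whereas tau is 0 on aff(P). *)
have [_ cgray] := cg_iter_segment R n Q S xb vR 1 k (fun p Sp => Sp.2)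
  (fun p Sp => PQ p Sp.1) (Phull xb Pxb) vint Qray.
have := cgaff _ (cgray 1 ler01 (lexx _)) => /tau0.
by rewrite -/(evR _ _) tau_ray; [move/eqP; rewrite oner_eq0 | apply: sub_aff].
Qed.
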